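(* Let $\Omega = \mathbb{R}^2/(2\pi\mathbb{Z})^2$ be the flat two-dimensional torus, let $\tau>0$ and $\lambda>0$, let $f$ be a given image on $\Omega$, let $\mathcal{S}$ be a set (the admissible parameter set), and let $F_1, F_2$ be maps assigning to each $\Theta\in\mathcal{S}$ real-valued functions $x\mapsto F_1(f,\Theta)(x)$, $x\mapsto F_2(f,\Theta)(x)$ in $L^1(\Omega)$. For measurable $u:\Omega\to\{0,1\}$ and $\Theta\in\mathcal{S}$ define $$\mathcal{E}^\tau(u,\Theta) = \int_\Omega \big[u\,F_1(f,\Theta) + (1-u)\,F_2(f,\Theta)\big]\,dx + \lambda\sqrt{\tfrac{\pi}{\tau}}\int_\Omega u\, \big(G_\tau*(1-u)\big)\,dx .$$ Let $(u^k,\Theta^k)_{k\ge 1}$ be any sequence generated by the following iteration (the two-phase ICTM), starting from a measurable $u^1:\Omega\to\{0,1\}$: (1) $\Theta^k \in \arg\min_{\Theta\in\mathcal{S}} \int_\Omega \big[u^k F_1(f,\Theta) + (1-u^k)F_2(f,\Theta)\big]\,dx$ (a minimizer is assumed to exist at every step); (2) $\phi^k = F_1(f,\Theta^k) - F_2(f,\Theta^k) + \lambda\sqrt{\tfrac{\pi}{\tau}}\, G_\tau*(1-2u^k)$; (3) $u^{k+1}(x) = 1$ if $\phi^k(x)\le 0$ and $u^{k+1}(x)=0$ otherwise. Then for every $k\ge1$ and every $\tau>0$, $$\mathcal{E}^\tau(u^{k+1},\Theta^{k+1}) \le \mathcal{E}^\tau(u^k,\Theta^k).$$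
   Context: $G_\tau$ denotes the heat kernel on the torus $\Omega$, i.e. the $2\pi\mathbb{Z}^2$-periodization $G_\tau(x)=\sum_{m\in\mathbb{Z}^2}\frac{1}{4\pi\tau}\exp\!\big(-\frac{|x+2\pi m|^2}{4\tau}\big)$ of the Gaussian $\frac{1}{4\pi\tau}e^{-|x|^2/(4\tau)}$, and $*$ is convolution on $\Omega$: $(G_\tau*v)(x)=\int_\Omega G_\tau(x-y)v(y)\,dy$. The term $\sqrt{\pi/\tau}\int_\Omega u\,G_\tau*(1-u)\,dx$ is the paper's heat-kernel approximation of the perimeter of the set $\{u=1\}$; $F_1,F_2$ are the fidelity integrands of a general two-phase segmentation energy, and $\Theta$ collects all parameters/functions appearing in them. *)

(* Defs.v *)
From HB Require Import structures.
From mathcomp Require Import all_boot all_order all_algebra.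
From mathcomp Require Import all_classical all_reals all_analysis.
Set Implicit Arguments. Unset Strict Implicit. Unset Printing Implicit Defensive.
Import Order.TTheory GRing.Theory Num.Theory.
Import numFieldNormedType.Exports.
Local Open Scope classical_set_scope.
Local Open Scope ring_scope.

(* The torus Omega = R^2/(2pi Z)^2 is represented by its fundamental domain
   [0,2pi) x [0,2pi) in R*R with the (product) Lebesgue measure.
   Functions on Omega are functions R*R -> R of which only the values on
   the fundamental domain matter (all convolution kernels below are
   2pi-periodic, so x - y may be taken in R^2). *)

Definition leb2 (R : realType) :=
  ((@lebesgue_measure R) \x (@lebesgue_measure R))%E.
Arguments leb2 R : clear implicits.

Definition Omega (R : realType) : set (R * R) :=
  `[0%R, 2 * pi[%classic `*` `[0%R, 2 * pi[%classic.
Arguments Omega R : clear implicits.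

Definition intO (R : realType) (g : R * R -> R) : R :=
  Rintegral (leb2 R) (Omega R) g.

Definition heat_kernel (R : realType) (tau : R) (x : R * R) : R :=
  fine (\esum_(m in [set: int * int])
    ((1 / (4 * pi * tau)) *
      expR (- (((x.1 + 2 * pi * m.1%:~R) ^+ 2 + (x.2 + 2 * pi * m.2%:~R) ^+ 2)
               / (4 * tau))))%:E)%E.

Definition convO (R : realType) (G v : R * R -> R) (x : R * R) : R :=
  intO (fun y => G (x - y)%R * v y).

Definition fidelity (R : realType) (F1 F2 : R * R -> R) (u : R * R -> R) : R :=
  intO (fun x => u x * F1 x + (1 - u x) * F2 x).

Definition energy (R : realType) (tau lambda : R) (F1 F2 : R * R -> R)
  (u : R * R -> R) : R :=
  fidelity F1 F2 u +
  lambda * Num.sqrt (pi / tau) *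
    intO (fun x => u x * convO (heat_kernel tau) (fun y => 1 - u y) x).

(* Main.v *)
Require Import Defs.
From HB Require Import structures.
From mathcomp Require Import all_boot all_order all_algebra.
From mathcomp Require Import all_classical all_reals all_analysis.
From mathcomp Require Import measurable_realfun ring lra.
Set Implicit Arguments. Unset Strict Implicit. Unset Printing Implicit Defensive.
Import Order.TTheory GRing.Theory Num.Theory.
Import numFieldNormedType.Exports.
Local Open Scope classical_set_scope.
Local Open Scope ring_scope.

(** Minimizing over Theta lowers only the fidelity term, so everything rests on
    the thresholding step from w = u^k to v = u^(k+1).  At fixed Theta^k the
    energy E is quadratic in u, and with
    B(v, w) = int int G_tau(x - y) v(x) w(y) dy dx one has
    E(w) - E(v) = int (w - v) phi + lambda (pi/tau)^(1/2) B(w - v, w - v),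
    where phi = phi^k is the gradient of E at w.  Thresholding phi at 0 makes
    the first integrand nonnegative, and B is positive semidefinite by the
    Chapman-Kolmogorov identity
    G_tau(x - y) = int G_(tau/2)(x - z) G_(tau/2)(y - z) dz, which turns B(u, u)
    into the square of the L2 norm of G_(tau/2) * u.  On the torus this identity
    is the periodization of the one for Gaussians on the line. *)

(** * Sums over countable types *)

Section countable_esum.
Context {R : realType} {I : countType}.
Local Open Scope ereal_scope.

Lemma esum_nneseries (a : I -> \bar R) : (forall i, 0 <= a i) ->
  \esum_(i in [set: I]) a i = \sum_(n <oo) oapp a 0 (pickle_inv n).
Proof.
move=> a_ge0; rewrite nneseries_esumT => [|n]; last by case: pickle_inv => /=.
transitivity (\esum_(n in range (@pickle I)) oapp a 0 (pickle_inv n)).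
  rewrite esum_image; last by move=> i j _ _; exact: (pcan_inj pickleK_inv).
  by apply: eq_esum => i _; rewrite pickleK_inv.
rewrite esum_mkcond; apply: eq_esum => n _; case: ifPn => // /negP n_code.
case: pickle_inv (@pickle_invK I n) => //= i codei.
by case: n_code; rewrite inE; exists i.
Qed.

Lemma ge0_esumZl (c : \bar R) (a : I -> \bar R) :
  0 <= c -> (forall i, 0 <= a i) ->
  \esum_(i in [set: I]) (c * a i) = c * \esum_(i in [set: I]) a i.
Proof.
case: c => [c||//] c_ge0 a_ge0.
  rewrite !esum_nneseries// => [|i]; last exact: mule_ge0.
  rewrite -nneseriesZl => [|n _]; last by case: pickle_inv => /=.
  by apply: eq_eseriesr => n _; case: pickle_inv => //=; rewrite mule0.
have [a0|/existsNP[i /eqP ai_neq0]] := pselect (forall i, a i = 0).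
  by rewrite !esum1 ?mule0// => i _; rewrite a0 ?mule0.
have ai_gt0 : 0 < a i by rewrite lt_neqAle eq_sym ai_neq0 a_ge0.
have term_le_esum (b : I -> \bar R) : b i <= \esum_(i in [set: I]) b i.
  by apply: esum_ge; exists [set i]; rewrite ?fsbig_set1.
rewrite [RHS]gt0_mulye; last exact: lt_le_trans (term_le_esum a).
apply/eqP; rewrite -leye_eq.
by apply: le_trans (term_le_esum (fun i => +oo * a i)); rewrite gt0_mulye.
Qed.

Context {d : measure_display} {T : measurableType d}.
Variables (D : set T) (f : I -> T -> \bar R).
Hypothesis f_ge0 : forall i x, 0 <= f i x.
Hypothesis mf : forall i, measurable_fun D (f i).

Let term n x := oapp (f^~ x) 0 (@pickle_inv I n).

Let term_ge0 n x : 0 <= term n x.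
Proof. by rewrite /term; case: pickle_inv => /=. Qed.

Let measurable_term n : measurable_fun D (term n).
Proof. by rewrite /term; case: pickle_inv => //=. Qed.

Lemma ge0_emeasurable_esum :
  measurable_fun D (fun x => \esum_(i in [set: I]) f i x).
Proof.
under eq_fun do rewrite esum_nneseries//.
apply: (ge0_emeasurable_sum (h := term) (P := xpredT)) => n.
  by move=> x _ _; exact: term_ge0.
by move=> _; exact: measurable_term.
Qed.

Lemma ge0_integral_esum (mu : {measure set T -> \bar R}) : measurable D ->
  \int[mu]_(x in D) (\esum_(i in [set: I]) f i x) =
  \esum_(i in [set: I]) (\int[mu]_(x in D) f i x).
Proof.
move=> mD; under eq_integral do rewrite esum_nneseries//.
rewrite (integral_nneseries _ mD measurable_term)//.
rewrite esum_nneseries => [|i]; last exact: integral_ge0.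
apply: eq_eseriesr => n _; rewrite /term.
by case: pickle_inv => //=; rewrite integral0.
Qed.

End countable_esum.

Lemma ge0_esumM {R : realType} {I J : countType} (a : I -> \bar R)
    (b : J -> \bar R) :
  (forall i, 0 <= a i)%E -> (forall j, 0 <= b j)%E ->
  ((\esum_(i in [set: I]) a i) * (\esum_(j in [set: J]) b j) =
   \esum_(k in [set: I * J]) (a k.1 * b k.2))%E.
Proof.
move=> a_ge0 b_ge0; transitivity
  (\esum_(i in [set: I]) \esum_(j in [set: J]) (a i * b j))%E.
  rewrite muleC -ge0_esumZl//; last exact: esum_ge0.
  by apply: eq_esum => i _; rewrite muleC ge0_esumZl.
by rewrite esum_esum => [|i j _ _]; [congr esum; apply/seteqP|exact: mule_ge0].
Qed.

(** * Integral operators with bounded kernels *)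

Definition bounded_mfun {d : measure_display} {T : measurableType d}
    {R : realType} (D : set T) (f : T -> R) :=
  measurable_fun D f /\ exists B : R, forall x, D x -> `|f x| <= B.

Section bounded_mfun.
Context {d : measure_display} {T : measurableType d} {R : realType}.
Implicit Types (D : set T) (f g : T -> R).

Lemma bounded_mfun_cst D (c : R) : bounded_mfun D (fun=> c).
Proof. by split => //; exists `|c|. Qed.

Lemma bounded_mfunB D f g :
  bounded_mfun D f -> bounded_mfun D g -> bounded_mfun D (fun x => f x - g x).
Proof.
move=> [mf [B fB]] [mg [C gC]]; split; first exact: measurable_funB.
by exists (B + C) => x Dx; rewrite (le_trans (ler_normB _ _))// lerD ?fB ?gC.
Qed.

Lemma bounded_mfunM D f g :
  bounded_mfun D f -> bounded_mfun D g -> bounded_mfun D (fun x => f x * g x).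
Proof.
move=> [mf [B fB]] [mg [C gC]]; split; first exact: measurable_funM.
by exists (B * C) => x Dx; rewrite normrM ler_pM ?fB ?gC.
Qed.

Lemma bounded_mfun_onem_double D f :
  bounded_mfun D f -> bounded_mfun D (fun x => 1 - 2 * f x).
Proof.
move=> bf; apply: bounded_mfunB; first exact: bounded_mfun_cst.
exact: bounded_mfunM (bounded_mfun_cst D 2) bf.
Qed.

Lemma bounded_mfun_unit D f :
  measurable_fun D f -> (forall x, D x -> 0 <= f x <= 1) -> bounded_mfun D f.
Proof.
move=> mf f01; split=> //; exists 1 => x /f01 /andP[f_ge0 f_le1].
by rewrite ger0_norm.
Qed.

Lemma bounded_mfun_comp {d' : measure_display} {T' : measurableType d'}
    D (D' : set T') f (h : T' -> T) : measurable D ->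
  measurable_fun [set: T'] h -> (forall x, D' x -> D (h x)) ->
  bounded_mfun D f -> bounded_mfun D' (fun x => f (h x)).
Proof.
move=> mD mh D'D [mf [B fB]]; split; last by exists B => x /D'D; exact: fB.
apply: (measurable_comp mD _ mf); last exact: measurable_funTS.
by move=> _ [x D'x <-]; exact: D'D.
Qed.

Lemma bounded_mfun_bounded D f : bounded_mfun D f -> [bounded f x | x in D].
Proof.
move=> [_ [B fB]]; exists B; split; first exact: num_real.
by move=> M /ltW BM x Dx; exact: le_trans (fB x Dx) BM.
Qed.

Lemma bounded_mfun_integrable (mu : {measure set T -> \bar R}) D f :
  measurable D -> (mu D < +oo)%E -> bounded_mfun D f ->
  mu.-integrable D (EFin \o f).
Proof.
move=> mD Dfin bf; apply: measurable_bounded_integrable => //.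
  by case: bf.
exact: bounded_mfun_bounded.
Qed.

Lemma bounded_mfunM_integrable (mu : {measure set T -> \bar R}) D f g :
  measurable D -> bounded_mfun D f -> mu.-integrable D (EFin \o g) ->
  mu.-integrable D (EFin \o (fun x => f x * g x)).
Proof.
move=> mD bf ig; apply: (@integrableMr _ _ _ _ _ mD f (EFin \o g)) => //.
  by case: bf.
exact: bounded_mfun_bounded.
Qed.

End bounded_mfun.

Section bounded_kernel.
Context {d1 d2 : measure_display} {T1 : measurableType d1}
  {T2 : measurableType d2} {R : realType}.
Variables (D : set T1) (E : set T2).
Hypotheses (mD : measurable D) (mE : measurable E).
Implicit Types (k : T1 -> T2 -> R) (v : T1 -> R) (w : T2 -> R).

Definition bounded_kernel k := bounded_mfun (D `*` E) (fun p => k p.1 p.2).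

Lemma bounded_kernelM k1 k2 : bounded_kernel k1 -> bounded_kernel k2 ->
  bounded_kernel (fun x y => k1 x y * k2 x y).
Proof. exact: bounded_mfunM. Qed.

Lemma bounded_kernel_fst v :
  bounded_mfun D v -> bounded_kernel (fun x _ => v x).
Proof.
by apply: (bounded_mfun_comp mD (@measurable_fst _ _ T1 T2)) => p [].
Qed.

Lemma bounded_kernel_snd w :
  bounded_mfun E w -> bounded_kernel (fun _ y => w y).
Proof.
by apply: (bounded_mfun_comp mE (@measurable_snd _ _ T1 T2)) => p [].
Qed.

Lemma bounded_kernel_section k x :
  bounded_kernel k -> D x -> bounded_mfun E (k x).
Proof.
move=> bk Dx; have mDE : measurable (D `*` E) by exact: measurableX.
by apply: (bounded_mfun_comp mDE (pair1_measurable x) _ bk).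
Qed.

End bounded_kernel.

Lemma bounded_kernel_swap {d1 d2 : measure_display} {T1 : measurableType d1}
    {T2 : measurableType d2} {R : realType} (D : set T1) (E : set T2)
    (k : T1 -> T2 -> R) : measurable D -> measurable E ->
  bounded_kernel D E k -> bounded_kernel E D (fun y x => k x y).
Proof.
move=> mD mE; have mDE : measurable (D `*` E) by exact: measurableX.
by apply: (bounded_mfun_comp mDE (@measurable_swap _ _ T2 T1)) => p [].
Qed.

Definition restricted_kernel {T1 T2 : Type} {R : realType} (D : set T1)
    (E : set T2) (k : T1 -> T2 -> R) : T1 * T2 -> \bar R :=
  (fun p => (k p.1 p.2)%:E) \_ (D `*` E).

Section bounded_fubini.
Context {d1 d2 : measure_display} {T1 : measurableType d1}
  {T2 : measurableType d2} {R : realType}.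
Variables (m1 : {sigma_finite_measure set T1 -> \bar R})
  (m2 : {sigma_finite_measure set T2 -> \bar R}).
Variables (D : set T1) (E : set T2).
Hypotheses (mD : measurable D) (Dfin : (m1 D < +oo)%E).
Hypotheses (mE : measurable E) (Efin : (m2 E < +oo)%E).
Variable k : T1 -> T2 -> R.
Hypothesis bk : bounded_kernel D E k.

Lemma integral_restricted_kernel x :
  (\int[m2]_y restricted_kernel D E k (x, y))%E =
  ((EFin \o (fun x => \int[m2]_(y in E) k x y)) \_ D) x.
Proof.
rewrite patchE; case: ifPn => [/set_mem Dx|/negP Dx] /=.
  rewrite fineK; last first.
    apply: integrable_fin_num => //; apply: bounded_mfun_integrable => //.
    exact: bounded_kernel_section bk Dx.
  rewrite [RHS]integral_mkcond; apply: eq_integral => y _.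
  by rewrite /restricted_kernel !patchE in_setX mem_set.
apply: integral0_eq => y _; rewrite /restricted_kernel patchE in_setX /=.
by rewrite (negbTE (introN idP Dx)).
Qed.

Lemma integrable_restricted_kernel :
  (m1 \x m2)%E.-integrable [set: T1 * T2] (restricted_kernel D E k).
Proof.
have mDE : measurable (D `*` E) by exact: measurableX.
apply/(integrable_mkcond _ mDE); apply: bounded_mfun_integrable bk => //.
by rewrite /= product_measure1E// lte_mul_pinfty// ge0_fin_numE.
Qed.

Lemma measurable_Rintegral_kernel :
  measurable_fun D (fun x => \int[m2]_(y in E) k x y).
Proof.
apply/measurable_EFinP/(measurable_restrictT _ mD).
rewrite -(funext integral_restricted_kernel).
exact: measurable_fubini_F integrable_restricted_kernel.
Qed.

Lemma bounded_mfun_Rintegral_kernel :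
  bounded_mfun D (fun x => \int[m2]_(y in E) k x y).
Proof.
split; first exact: measurable_Rintegral_kernel.
have [_ [B kB]] := bk; exists (B * fine (m2 E)) => x Dx.
have ik : m2.-integrable E (EFin \o k x).
  by apply: bounded_mfun_integrable => //; exact: bounded_kernel_section bk Dx.
rewrite (le_trans (le_normr_Rintegral mE ik))// -Rintegral_cst//.
apply: le_Rintegral => //; first exact: integrable_norm ik.
  by apply: bounded_mfun_integrable => //; exact: bounded_mfun_cst.
by move=> y Ey; apply: (kB (x, y)).
Qed.

End bounded_fubini.

Lemma Rintegral_kernel_swap {d1 d2 : measure_display} {T1 : measurableType d1}
    {T2 : measurableType d2} {R : realType}
    (m1 : {sigma_finite_measure set T1 -> \bar R})
    (m2 : {sigma_finite_measure set T2 -> \bar R})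
    (D : set T1) (E : set T2) (k : T1 -> T2 -> R) :
  measurable D -> (m1 D < +oo)%E -> measurable E -> (m2 E < +oo)%E ->
  bounded_kernel D E k ->
  \int[m1]_(x in D) (\int[m2]_(y in E) k x y) =
  \int[m2]_(y in E) (\int[m1]_(x in D) k x y).
Proof.
move=> mD Dfin mE Efin bk; have bkT := bounded_kernel_swap mD mE bk.
rewrite /Rintegral; congr fine; rewrite integral_mkcond [RHS]integral_mkcond.
under eq_integral do rewrite -integral_restricted_kernel//.
under [RHS]eq_integral do rewrite -integral_restricted_kernel//.
rewrite Fubini; last exact: integrable_restricted_kernel.
apply: eq_integral => y _; apply: eq_integral => x _.
by rewrite /restricted_kernel !patchE !in_setX andbC.
Qed.

Definition kernel_op {d : measure_display} {T1 : Type} {T2 : measurableType d}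
    {R : realType} (mu : {measure set T2 -> \bar R}) (E : set T2)
    (k : T1 -> T2 -> R) (w : T2 -> R) (x : T1) : R :=
  \int[mu]_(y in E) (k x y * w y).

Section kernel_op.
Context {d1 d2 : measure_display} {T1 : measurableType d1}
  {T2 : measurableType d2} {R : realType}.
Variables (m1 : {sigma_finite_measure set T1 -> \bar R})
  (m2 : {sigma_finite_measure set T2 -> \bar R}).
Variables (D : set T1) (E : set T2).
Hypotheses (mD : measurable D) (Dfin : (m1 D < +oo)%E).
Hypotheses (mE : measurable E) (Efin : (m2 E < +oo)%E).
Variable k : T1 -> T2 -> R.
Hypothesis bk : bounded_kernel D E k.
Implicit Types (v : T1 -> R) (w : T2 -> R).

Lemma bounded_mfun_kernel_op w :
  bounded_mfun E w -> bounded_mfun D (kernel_op m2 E k w).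
Proof.
move=> bw; apply: (bounded_mfun_Rintegral_kernel mD Dfin mE Efin).
exact: bounded_kernelM bk (bounded_kernel_snd _ mE bw).
Qed.

Lemma kernel_opB w1 w2 x : bounded_mfun E w1 -> bounded_mfun E w2 -> D x ->
  kernel_op m2 E k (fun y => w1 y - w2 y) x =
  kernel_op m2 E k w1 x - kernel_op m2 E k w2 x.
Proof.
move=> bw1 bw2 Dx; have bkx := bounded_kernel_section mD mE bk Dx.
rewrite /kernel_op -RintegralB//.
- by apply: eq_Rintegral => y _; rewrite mulrBr.
- by apply: bounded_mfun_integrable => //; exact: bounded_mfunM.
- by apply: bounded_mfun_integrable => //; exact: bounded_mfunM.
Qed.

Lemma kernel_op_adjoint v w : bounded_mfun D v -> bounded_mfun E w ->
  \int[m1]_(x in D) (v x * kernel_op m2 E k w x) =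
  \int[m2]_(y in E) (kernel_op m1 D (fun y x => k x y) v y * w y).
Proof.
move=> bv bw; transitivity
  (\int[m1]_(x in D) \int[m2]_(y in E) (v x * (k x y * w y))).
  apply: eq_Rintegral => x /set_mem Dx; rewrite -RintegralZl//.
  apply: bounded_mfun_integrable => //; apply: bounded_mfunM => //.
  exact: bounded_kernel_section bk Dx.
rewrite (Rintegral_kernel_swap mD Dfin mE Efin); last first.
  apply: bounded_kernelM (bounded_kernel_fst _ mD bv) _.
  exact: bounded_kernelM bk (bounded_kernel_snd _ mE bw).
apply: eq_Rintegral => y /set_mem Ey; rewrite -RintegralZr//.
  by apply: eq_Rintegral => x _; ring.
apply: bounded_mfun_integrable => //; apply: bounded_mfunM => //.
exact: bounded_kernel_section (bounded_kernel_swap mD mE bk) Ey.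
Qed.

End kernel_op.

(** * Positive semidefinite kernels *)

Section quadratic_form.
Context {d : measure_display} {T : measurableType d} {R : realType}.
Variables (mu : {sigma_finite_measure set T -> \bar R}) (D : set T).
Hypotheses (mD : measurable D) (Dfin : (mu D < +oo)%E).
Implicit Types (K : T -> T -> R) (u v w : T -> R).

Definition bform K v w : R := \int[mu]_(x in D) (v x * kernel_op mu D K w x).

Let bounded_integrable v : bounded_mfun D v -> mu.-integrable D (EFin \o v).
Proof. exact: bounded_mfun_integrable. Qed.

Lemma bformBl K v1 v2 w : bounded_kernel D D K ->
  bounded_mfun D v1 -> bounded_mfun D v2 -> bounded_mfun D w ->
  bform K (fun x => v1 x - v2 x) w = bform K v1 w - bform K v2 w.
Proof.
move=> bK b1 b2 bw; have bKw := bounded_mfun_kernel_op mD Dfin mD Dfin bK bw.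
rewrite /bform -RintegralB//; [|exact/bounded_integrable/bounded_mfunM..].
by apply: eq_Rintegral => x _; rewrite mulrBl.
Qed.

Lemma bformBr K v w1 w2 : bounded_kernel D D K ->
  bounded_mfun D v -> bounded_mfun D w1 -> bounded_mfun D w2 ->
  bform K v (fun x => w1 x - w2 x) = bform K v w1 - bform K v w2.
Proof.
move=> bK bv b1 b2.
have bKw w := bounded_mfun_kernel_op mD Dfin mD Dfin bK (w := w).
rewrite /bform -RintegralB//; last 2 first.
- by apply/bounded_integrable/bounded_mfunM => //; exact: bKw.
- by apply/bounded_integrable/bounded_mfunM => //; exact: bKw.
apply: eq_Rintegral => x /set_mem Dx.
by rewrite -mulrBr (kernel_opB mD mD Dfin bK).
Qed.

Lemma bformC K v w : bounded_kernel D D K ->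
  (forall x y, D x -> D y -> K x y = K y x) ->
  bounded_mfun D v -> bounded_mfun D w -> bform K v w = bform K w v.
Proof.
move=> bK Ksym bv bw.
rewrite /bform (kernel_op_adjoint mD Dfin mD Dfin bK bv bw).
apply: eq_Rintegral => y /set_mem Dy; rewrite mulrC; congr (_ * _).
by apply: eq_Rintegral => x /set_mem Dx; rewrite Ksym.
Qed.

Definition psd_kernel K := [/\ bounded_kernel D D K,
  forall x y, D x -> D y -> K x y = K y x &
  forall u, bounded_mfun D u -> 0 <= bform K u u].

(* A Gram kernel is positive semidefinite since its quadratic form at u is the
   squared L2 norm of the image of u under the transposed feature map. *)
Lemma psd_kernel_gram {d' : measure_display} {T' : measurableType d'}
    (nu : {sigma_finite_measure set T' -> \bar R}) (E : set T')
    (phi : T -> T' -> R) K :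
  measurable E -> (nu E < +oo)%E ->
  bounded_kernel D E phi -> bounded_kernel D D K ->
  (forall x y, D x -> D y ->
     K x y = \int[nu]_(z in E) (phi x z * phi y z)) ->
  psd_kernel K.
Proof.
move=> mE Efin bphi bK KE; split => // [x y Dx Dy|u bu].
  by rewrite !KE//; apply: eq_Rintegral => z _; rewrite mulrC.
have bphiT := bounded_kernel_swap mD mE bphi.
pose Pu := kernel_op mu D (fun z x => phi x z) u.
have bPu : bounded_mfun E Pu := bounded_mfun_kernel_op mE Efin mD Dfin bphiT bu.
rewrite (_ : bform K u u = \int[mu]_(x in D) (u x * kernel_op nu E phi Pu x)).
  rewrite (kernel_op_adjoint mD Dfin mE Efin bphi bu bPu).
  by apply: Rintegral_ge0 => z _; rewrite -expr2 sqr_ge0.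
apply: eq_Rintegral => x /set_mem Dx; congr (_ * _).
rewrite /kernel_op (kernel_op_adjoint mE Efin mD Dfin bphiT) //; last first.
  exact: bounded_kernel_section bphi Dx.
apply: eq_Rintegral => y /set_mem Dy; rewrite KE//; congr (_ * _).
by apply: eq_Rintegral => z _; rewrite mulrC.
Qed.

End quadratic_form.

(** * The thresholding step *)

Section two_phase_energy.
Context {d : measure_display} {T : measurableType d} {R : realType}.
Variables (mu : {sigma_finite_measure set T -> \bar R}) (D : set T).
Hypotheses (mD : measurable D) (Dfin : (mu D < +oo)%E).
Variables (K : T -> T -> R) (c : R) (F1 F2 : T -> R).
Hypothesis bK : bounded_kernel D D K.
Hypothesis iF1 : mu.-integrable D (EFin \o F1).
Hypothesis iF2 : mu.-integrable D (EFin \o F2).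
Implicit Types u v w : T -> R.

Definition two_phase_fidelity u : R :=
  \int[mu]_(x in D) (u x * F1 x + (1 - u x) * F2 x).

Definition two_phase_energy u : R :=
  two_phase_fidelity u + c * bform mu D K u (fun x => 1 - u x).

Definition energy_gradient w (x : T) : R :=
  F1 x - F2 x + c * kernel_op mu D K (fun y => 1 - 2 * w y) x.

Lemma two_phase_fidelity_diff v w : bounded_mfun D v -> bounded_mfun D w ->
  two_phase_fidelity v - two_phase_fidelity w =
  \int[mu]_(x in D) ((v x - w x) * (F1 x - F2 x)).
Proof.
move=> bv bw.
have iuF u : bounded_mfun D u ->
    mu.-integrable D (EFin \o (fun x => u x * F1 x + (1 - u x) * F2 x)).
  move=> bu; have b1u := bounded_mfunB (bounded_mfun_cst D 1) bu.
  have i1 := bounded_mfunM_integrable mD bu iF1.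
  exact: (integrableD mD i1 (bounded_mfunM_integrable mD b1u iF2)).
rewrite -RintegralB//; [|exact: iuF..].
by apply: eq_Rintegral => x _; ring.
Qed.

Lemma Rintegral_energy_gradient f w : bounded_mfun D f -> bounded_mfun D w ->
  \int[mu]_(x in D) (f x * energy_gradient w x) =
  \int[mu]_(x in D) (f x * (F1 x - F2 x)) +
  c * bform mu D K f (fun y => 1 - 2 * w y).
Proof.
move=> bf bw; have bw2 := bounded_mfun_onem_double bw.
have bfK := bounded_mfunM bf (bounded_mfun_kernel_op mD Dfin mD Dfin bK bw2).
have iF12 := bounded_mfunM_integrable mD bf (integrableB mD iF1 iF2).
have icfK := integrableZl mD c (bounded_mfun_integrable mD Dfin bfK).
rewrite /bform -RintegralZl//; last exact: bounded_mfun_integrable.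
rewrite -(RintegralD mD iF12 icfK).
by apply: eq_Rintegral => x _; rewrite /energy_gradient; ring.
Qed.

Lemma two_phase_energy_drop v w :
  (forall x y, D x -> D y -> K x y = K y x) ->
  bounded_mfun D v -> bounded_mfun D w ->
  two_phase_energy w - two_phase_energy v =
    \int[mu]_(x in D) ((w x - v x) * energy_gradient w x) +
    c * bform mu D K (fun x => w x - v x) (fun x => w x - v x).
Proof.
move=> Ksym bv bw; have b1 := bounded_mfun_cst D (1 : R).
have b1w := bounded_mfunB b1 bw; have b1ww := bounded_mfunB b1w bw.
have bwv := bounded_mfunB bw bv.
rewrite Rintegral_energy_gradient// -two_phase_fidelity_diff//.
rewrite /two_phase_energy.
rewrite (_ : (fun y => 1 - 2 * w y) = (fun y => (1 - w y) - w y)); last first.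
  by apply/funext => y; ring.
rewrite !(bformBr mD Dfin bK, bformBl mD Dfin bK)//.
by rewrite (bformC mD Dfin bK Ksym bw bv); ring.
Qed.

Section threshold.
Variables v w : T -> R.
Hypothesis bw : bounded_mfun D w.
Hypothesis vE :
  forall x, D x -> v x = if energy_gradient w x <= 0 then 1 else 0.

Lemma threshold_unit x : D x -> 0 <= v x <= 1.
Proof. by move=> /vE ->; case: ifP; rewrite lexx ler01. Qed.

Lemma measurable_threshold : measurable_fun D v.
Proof.
apply: (eq_measurable_fun
  (fun x => if energy_gradient w x <= 0 then 1 else 0 : R)).
  by move=> x /set_mem /vE.
have mF1 : measurable_fun D F1.
  by apply/measurable_EFinP; exact: measurable_int iF1.
have mF2 : measurable_fun D F2.
  by apply/measurable_EFinP; exact: measurable_int iF2.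
apply: measurable_fun_if => //; apply: measurable_fun_ler => //.
apply: measurable_funD; first exact: measurable_funB.
apply: measurable_funM => //.
have bw2 := bounded_mfun_onem_double bw.
by have [] := bounded_mfun_kernel_op mD Dfin mD Dfin bK bw2.
Qed.

Lemma threshold_gradient_ge0 x :
  D x -> 0 <= w x <= 1 -> 0 <= (w x - v x) * energy_gradient w x.
Proof.
move=> Dx /andP[w_ge0 w_le1]; rewrite vE//; case: ifPn => [grad_le0|].
  by rewrite mulr_le0// subr_le0.
by rewrite -ltNge => /ltW grad_ge0; rewrite subr0 mulr_ge0.
Qed.

Lemma threshold_energy_le : 0 <= c -> psd_kernel mu D K ->
  (forall x, D x -> 0 <= w x <= 1) -> two_phase_energy v <= two_phase_energy w.
Proof.
move=> c_ge0 [_ Ksym Kpsd] w01.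
have bv := bounded_mfun_unit measurable_threshold threshold_unit.
rewrite -subr_ge0 (two_phase_energy_drop Ksym bv bw) addr_ge0//.
  by apply: Rintegral_ge0 => x Dx; exact: threshold_gradient_ge0 (w01 x Dx).
by rewrite mulr_ge0// Kpsd//; exact: bounded_mfunB.
Qed.

End threshold.
End two_phase_energy.

(** * Product measures *)

Section product_sigma_finite.
Context {d1 d2 : measure_display} {T1 : measurableType d1}
  {T2 : measurableType d2} {R : realType}.
Variables (m1 : {sigma_finite_measure set T1 -> \bar R})
  (m2 : {sigma_finite_measure set T2 -> \bar R}).

Lemma sigma_finite_product_measure1 : sigma_finite setT (m1 \x m2)%E.
Proof.
have /sigma_finiteP[F [FT ndF F_fin]] := sigma_finiteT m1.
have /sigma_finiteP[G [GT ndG G_fin]] := sigma_finiteT m2.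
exists (fun n => F n `*` G n).
  rewrite -setXTT FT GT; apply/seteqP; split=> -[x y].
    move=> [/= [i _ Fix] [j _ Gjy]]; exists (maxn i j) => //; split.
    - by move: x Fix; exact/subsetPset/ndF/leq_maxl.
    - by move: y Gjy; exact/subsetPset/ndG/leq_maxr.
  by move=> [n _ []/= ? ?]; split; exists n.
move=> n; have [mF F_lty] := F_fin n; have [mG G_lty] := G_fin n.
split; first exact: measurableX.
by rewrite product_measure1E// lte_mul_pinfty// ge0_fin_numE.
Qed.

(* The canonical sigma-finite structure on product measures only covers
   products of subprobabilities. *)
Definition sigma_finite_product :
    {sigma_finite_measure set (T1 * T2)%type -> \bar R} :=
  HB.pack (m1 \x m2)%E
    (Measure_isSigmaFinite.Build _ _ _ (m1 \x m2)%E
      sigma_finite_product_measure1).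

End product_sigma_finite.

Lemma ge0_integral_setXM {d1 d2 : measure_display} {T1 : measurableType d1}
    {T2 : measurableType d2} {R : realType}
    (m1 : {sigma_finite_measure set T1 -> \bar R})
    (m2 : {sigma_finite_measure set T2 -> \bar R}) (A : set T1) (B : set T2)
    (f : T1 -> \bar R) (g : T2 -> \bar R) :
  measurable A -> measurable_fun A f -> (forall x, A x -> 0 <= f x)%E ->
  measurable B -> measurable_fun B g -> (forall y, B y -> 0 <= g y)%E ->
  (\int[m1 \x m2]_(z in A `*` B) (f z.1 * g z.2) =
   \int[m1]_(x in A) f x * \int[m2]_(y in B) g y)%E.
Proof.
move=> mA mf f_ge0 mB mg g_ge0; rewrite integral_mkcond.
have -> : (fun z => f z.1 * g z.2)%E \_ (A `*` B) =
    (fun z => (f \_ A) z.1 * (g \_ B) z.2)%E.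
  apply/funext => -[x y]; rewrite !patchE in_setX /=.
  by case: (x \in A) (y \in B) => -[] //=; rewrite ?mule0 ?mul0e.
have fA_ge0 x : (0 <= (f \_ A) x)%E.
  by rewrite patchE; case: ifPn => // /set_mem; exact: f_ge0.
have gB_ge0 y : (0 <= (g \_ B) y)%E.
  by rewrite patchE; case: ifPn => // /set_mem; exact: g_ge0.
have mfA : measurable_fun setT (f \_ A) by exact/(measurable_restrictT _ mA).
have mgB : measurable_fun setT (g \_ B) by exact/(measurable_restrictT _ mB).
rewrite fubini_tonelli1; last 2 first.
- by apply: emeasurable_funM; [apply: measurableT_comp|apply: measurableT_comp].
- by move=> z; exact: mule_ge0.
rewrite [in RHS]integral_mkcond [X in (_ * X)%E]integral_mkcond.
rewrite -ge0_integralZr//; last exact: integral_ge0.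
by apply: eq_integral => x _; rewrite /fubini_F /= ge0_integralZl.
Qed.

(** * Periodization *)

Section lebesgue_shift.
Context {R : realType}.
Local Open Scope ereal_scope.
Notation mu := (@lebesgue_measure R).

Lemma measurable_fun_shift {d : measure_display} {T : measurableType d}
    (f : R -> T) (a : R) : measurable_fun [set: R] f ->
  measurable_fun [set: R] (fun x => f (x + a)%R).
Proof. by move=> mf; apply: measurableT_comp => //; exact: measurable_funD. Qed.

Lemma measurable_fun_reflect {d : measure_display} {T : measurableType d}
    (f : R -> T) (a : R) : measurable_fun [set: R] f ->
  measurable_fun [set: R] (fun x => f (a - x)%R).
Proof. by move=> mf; apply: measurableT_comp => //; exact: measurable_funB. Qed.

Lemma lebesgue_measureD (a : R) (A : set R) : measurable A ->
  pushforward mu (+%R^~ a : _ -> measurableTypeR R) A = mu A.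
Proof.
move=> mA.
have mshift : measurable_fun [set: R] (+%R^~ a) by exact: measurable_funD.
apply/esym/lebesgue_measure_unique => //= _ [[b c]] _ <-; rewrite /pushforward.
have -> : (+%R^~ a) @^-1` `]b, c] = `](b - a)%R, (c - a)%R]%classic.
  by apply/seteqP; split=> x /=; rewrite !in_itv /= ltrBlDr lerBrDr.
rewrite !lebesgue_measure_itv /= !lte_fin ltrD2r.
by case: ifP => // _; rewrite -!EFinB; congr EFin; ring.
Qed.

Lemma ge0_integral_shift (f : R -> \bar R) (a : R) :
  measurable_fun [set: R] f -> (forall x, 0 <= f x) ->
  \int[mu]_x f (x + a)%R = \int[mu]_x f x.
Proof.
move=> mf f_ge0.
have mshift : measurable_fun [set: R] (+%R^~ a) by exact: measurable_funD.
transitivity (\int[pushforward mu (+%R^~ a : _ -> measurableTypeR R)]_x f x).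
  by rewrite ge0_integral_pushforward.
by apply: eq_measure_integral => //= A mA _; exact: lebesgue_measureD.
Qed.

End lebesgue_shift.

Section periodize.
Context {R : realType}.
Variable L : R.
Local Open Scope ereal_scope.
Notation mu := (@lebesgue_measure R).
Implicit Types (f g h : R -> \bar R) (x y : R) (n : int).

Definition periodize g x : \bar R :=
  \esum_(n in [set: int]) g (x + L * n%:~R)%R.

Lemma periodize_ge0 g x : (forall y, 0 <= g y) -> 0 <= periodize g x.
Proof. by move=> g_ge0; exact: esum_ge0. Qed.

Lemma periodize_period g x n : periodize g (x + L * n%:~R)%R = periodize g x.
Proof.
rewrite /periodize [RHS](@reindex_esum _ _ _ [set: int] _ (+%R n))//.
by apply: eq_esum => m _; congr g; rewrite intrD; ring.
Qed.

Lemma measurable_periodize g :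
  measurable_fun [set: R] g -> (forall x, 0 <= g x) ->
  measurable_fun [set: R] (periodize g).
Proof.
move=> mg g_ge0; apply: ge0_emeasurable_esum => // n.
exact: measurable_fun_shift.
Qed.

Hypothesis L_gt0 : (0 < L)%R.

Lemma mem_fundamental_itv x n :
  ((x - L * n%:~R)%R \in `[0%R, L[) = (n == Num.floor (x / L)).
Proof.
rewrite in_itv /= subr_ge0 ltrBlDr; apply/idP/eqP => [/andP[le_nx lt_xn]|->].
  apply/esym/floor_def.
  by rewrite ler_pdivlMr// ltr_pdivrMr// mulrC le_nx /= intrD; lra.
have /andP[] := floor_itv (x / L).
by rewrite ler_pdivlMr// ltr_pdivrMr// intrD => ? ?; apply/andP; split; lra.
Qed.

Lemma integral_unfold f :
  measurable_fun [set: R] f -> (forall x, 0 <= f x) ->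
  \int[mu]_x f x =
  \esum_(n in [set: int]) (\int[mu]_(x in `[0%R, L[) f (x + L * n%:~R)%R).
Proof.
move=> mf f_ge0; pose piece n := (fun x => f (x + L * n%:~R)%R) \_ `[0%R, L[.
have piece_ge0 n x : 0 <= piece n x by rewrite /piece patchE; case: ifP.
have mpiece n : measurable_fun [set: R] (piece n).
  apply/(measurable_restrictT _ (measurable_itv _)).
  by apply: measurable_funTS; exact: measurable_fun_shift.
transitivity (\esum_(n in [set: int]) (\int[mu]_x piece n (x - L * n%:~R)%R)).
  rewrite -ge0_integral_esum//; last by move=> n; exact: measurable_fun_shift.
  apply: eq_integral => x _.
  transitivity (\esum_(n in [set Num.floor (x / L)]) f x).
    by rewrite esum_set1.
  rewrite esum_mkcond; apply: eq_esum => n _.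
  by rewrite /piece patchE subrK mem_setE mem_fundamental_itv in_set1.
by apply: eq_esum => n _; rewrite ge0_integral_shift// [RHS]integral_mkcond.
Qed.

Lemma integral_periodize g :
  measurable_fun [set: R] g -> (forall x, 0 <= g x) ->
  \int[mu]_(x in `[0%R, L[) periodize g x = \int[mu]_x g x.
Proof.
move=> mg g_ge0; rewrite integral_unfold// ge0_integral_esum// => n.
by apply: measurable_funTS; exact: measurable_fun_shift.
Qed.

Lemma integral_periodizeM g h x y :
  measurable_fun [set: R] g -> (forall t, 0 <= g t) ->
  measurable_fun [set: R] h -> (forall t, 0 <= h t) ->
  \int[mu]_(z in `[0%R, L[) (periodize g (x - z)%R * periodize h (y - z)%R) =
  periodize (fun t => \int[mu]_z (g (t - z)%R * h (y - z)%R)) x.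
Proof.
move=> mg g_ge0 mh h_ge0.
have Pg_ge0 t := periodize_ge0 t g_ge0.
pose q z := periodize g (x - z)%R * h (y - z)%R.
have q_ge0 z : 0 <= q z by exact: mule_ge0.
have mq : measurable_fun [set: R] q.
  by apply: emeasurable_funM; apply: measurable_fun_reflect => //;
    exact: measurable_periodize.
transitivity (\int[mu]_z q z).
  rewrite integral_unfold// [RHS](@reindex_esum _ _ _ [set: int] _ -%R)//.
  rewrite -ge0_integral_esum//; last first.
    by move=> n; apply: measurable_funTS; exact: measurable_fun_shift.
  apply: eq_integral => z _; rewrite -ge0_esumZl//; apply: eq_esum => n _.
  by rewrite /q mulrNz mulrN opprD opprK !addrA periodize_period.
rewrite /periodize -ge0_integral_esum//; last 2 first.
- by move=> n z; exact: mule_ge0.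
- by move=> n; apply: emeasurable_funM; exact: measurable_fun_reflect.
apply: eq_integral => z _; rewrite /q muleC -ge0_esumZl//.
by apply: eq_esum => n _; rewrite muleC addrAC.
Qed.

End periodize.

(** * Heat kernels on the line, the circle and the torus *)

Section line_heat_kernel.
Context {R : realType}.
Implicit Types r s t x y : R.
Notation mu := (@lebesgue_measure R).

Definition line_heat_kernel t x : R :=
  (Num.sqrt (4 * pi * t))^-1 * expR (- (x ^+ 2 / (4 * t))).

Lemma line_heat_kernel_ge0 t x : 0 <= line_heat_kernel t x.
Proof. by rewrite mulr_ge0 ?invr_ge0 ?sqrtr_ge0 ?expR_ge0. Qed.

Lemma measurable_line_heat_kernel t :
  measurable_fun [set: R] (line_heat_kernel t).
Proof.
apply: measurable_funM => //; apply: measurableT_comp => //.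
by apply: measurableT_comp => //; exact: measurable_funM.
Qed.

Lemma line_heat_kernel_normal_pdf t m x : 0 < t ->
  line_heat_kernel t (x - m) = normal_pdf m (Num.sqrt (2 * t)) x.
Proof.
move=> t_gt0; have t2_gt0 : 0 < 2 * t by rewrite mulr_gt0.
rewrite normal_pdfE ?gt_eqF ?sqrtr_gt0// /normal_peak /normal_fun.
rewrite sqr_sqrtr; last exact: ltW.
rewrite /line_heat_kernel; congr ((Num.sqrt _)^-1 * expR _); first by ring.
by field; rewrite gt_eqF.
Qed.

Lemma integral_line_heat_kernel t m : 0 < t ->
  (\int[mu]_x (line_heat_kernel t (x - m))%:E = 1)%E.
Proof.
move=> t_gt0; under eq_integral do rewrite line_heat_kernel_normal_pdf//.
exact: integral_normal_pdf.
Qed.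

(* Completing the square in z. *)
Lemma line_heat_kernelM s t x y z : 0 < s -> 0 < t ->
  line_heat_kernel s (x - z) * line_heat_kernel t (y - z) =
  line_heat_kernel (s + t) (x - y) *
  line_heat_kernel (s * t / (s + t)) (z - (t * x + s * y) / (s + t)).
Proof.
move=> s_gt0 t_gt0; have st_gt0 : 0 < s + t by rewrite addr_gt0.
rewrite /line_heat_kernel !mulrA ![_ * expR _ / _]mulrAC -!invfM -!mulrA.
rewrite -!expRD -!sqrtrM ?mulr_ge0 ?pi_ge0// ?ltW//.
by congr ((Num.sqrt _)^-1 * expR _); field; rewrite !gt_eqF.
Qed.

Lemma line_heat_kernel_chapman_kolmogorov s t x y : 0 < s -> 0 < t ->
  (\int[mu]_z (line_heat_kernel s (x - z) * line_heat_kernel t (y - z))%:E =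
   (line_heat_kernel (s + t) (x - y))%:E)%E.
Proof.
move=> s_gt0 t_gt0; under eq_integral do rewrite line_heat_kernelM// EFinM.
rewrite ge0_integralZl_EFin ?line_heat_kernel_ge0//.
- by rewrite integral_line_heat_kernel ?mule1// divr_gt0 ?mulr_gt0 ?addr_gt0.
- by move=> z _; rewrite lee_fin line_heat_kernel_ge0.
- apply/measurable_EFinP; apply: measurable_fun_shift.
  exact: measurable_line_heat_kernel.
Qed.

Lemma line_heat_kernel_le_double_time t r x y : 0 < t -> `|x - y| <= r ->
  line_heat_kernel t x <=
  Num.sqrt 2 * expR (r ^+ 2 / (4 * t)) * line_heat_kernel (2 * t) y.
Proof.
move=> t_gt0 xy_le.
rewrite /line_heat_kernel [leRHS]mulrACA -expRD.
have -> : Num.sqrt (4 * pi * (2 * t)) = Num.sqrt 2 * Num.sqrt (4 * pi * t) :> R.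
  by rewrite -sqrtrM//; congr Num.sqrt; ring.
rewrite [in leRHS]invfM mulVKf ?gt_eqF ?sqrtr_gt0//.
rewrite ler_wpM2l ?invr_ge0 ?sqrtr_ge0// ler_expR.
have : (x - y) ^+ 2 <= r ^+ 2.
  by rewrite -real_normK ?num_real// lerXn2r ?nnegrE// (le_trans _ xy_le).
move=> sqr_le.
rewrite -subr_ge0 (_ : _ - _ =
  ((2 * x - y) ^+ 2 + 2 * (r ^+ 2 - (x - y) ^+ 2)) / (8 * t)).
  by rewrite divr_ge0 ?mulr_ge0 ?addr_ge0 ?sqr_ge0// ?mulr_ge0 ?subr_ge0// ltW.
by field; rewrite gt_eqF.
Qed.

End line_heat_kernel.

Section circle_heat_kernel.
Context {R : realType}.
Implicit Types r s t x y : R.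
Notation mu := (@lebesgue_measure R).
Notation period := (2 * pi).

Let period_gt0 : 0 < period :> R. Proof. by rewrite mulr_gt0// pi_gt0. Qed.

Let measurable_line t : measurable_fun [set: R] (EFin \o line_heat_kernel t).
Proof. by apply/measurable_EFinP; exact: measurable_line_heat_kernel. Qed.

Let line_ge0 t x : (0 <= (EFin \o line_heat_kernel t) x)%E.
Proof. by rewrite lee_fin line_heat_kernel_ge0. Qed.

Definition periodized_heat_kernel t : R -> \bar R :=
  periodize period (EFin \o line_heat_kernel t).

Lemma periodized_heat_kernel_ge0 t x : (0 <= periodized_heat_kernel t x)%E.
Proof. exact: periodize_ge0 (line_ge0 t). Qed.

Lemma measurable_periodized_heat_kernel t :
  measurable_fun [set: R] (periodized_heat_kernel t).
Proof. exact: measurable_periodize (measurable_line t) (line_ge0 t). Qed.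

(* At points within bounded distance the kernel at time t is controlled by the
   one at time 2t, and averaging the latter over a period gives total mass 1. *)
Lemma periodized_heat_kernel_bounded t r : 0 < t ->
  exists C : R, forall x, `|x| <= r -> (periodized_heat_kernel t x <= C%:E)%E.
Proof.
move=> t_gt0.
pose A := Num.sqrt 2 * expR ((r + period) ^+ 2 / (4 * t)).
have A_ge0 : 0 <= A by rewrite mulr_ge0 ?sqrtr_ge0 ?expR_ge0.
have mI : measurable (`[0%R, period[%classic : set R) by exact: measurable_itv.
exists (period^-1 * A) => x x_le; rewrite EFinM lee_pdivlMl//.
have -> : A%:E = (\int[mu]_(y in `[0%R, period[)
    (A%:E * periodized_heat_kernel (2 * t) y))%E.
  rewrite ge0_integralZl_EFin//.
  - rewrite integral_periodize//.
    under eq_integral => y _ do rewrite /= -[y in line_heat_kernel _ y]subr0.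
    by rewrite integral_line_heat_kernel ?mule1// mulr_gt0.
  - by move=> y _; exact: periodized_heat_kernel_ge0.
  - by apply: measurable_funTS; exact: measurable_periodized_heat_kernel.
have -> : (period%:E * periodized_heat_kernel t x =
    \int[mu]_(y in `[0%R, period[) periodized_heat_kernel t x)%E.
  rewrite integral_cst// muleC /= lebesgue_measure_itv /= lte_fin period_gt0.
  by rewrite oppr0 adde0.
apply: ge0_le_integral => //.
- by move=> y _; exact: periodized_heat_kernel_ge0.
- apply: emeasurable_funM => //.
  by apply: measurable_funTS; exact: measurable_periodized_heat_kernel.
move=> y /=; rewrite in_itv /= => /andP[y_ge0 /ltW y_le].
rewrite -ge0_esumZl//; apply: le_esum => n _ /=.
rewrite -EFinM lee_fin; apply: line_heat_kernel_le_double_time => //.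
rewrite opprD addrACA subrr addr0 (le_trans (ler_normB _ _))// lerD//.
by rewrite ger0_norm.
Qed.

Definition circle_heat_kernel t x : R := fine (periodized_heat_kernel t x).

Lemma circle_heat_kernelE t x : 0 < t ->
  (circle_heat_kernel t x)%:E = periodized_heat_kernel t x.
Proof.
move=> t_gt0.
rewrite fineK// ge0_fin_numE; last exact: periodized_heat_kernel_ge0.
have [C C_ub] := periodized_heat_kernel_bounded `|x| t_gt0.
exact: le_lt_trans (C_ub x (lexx _)) (ltry _).
Qed.

Lemma circle_heat_kernel_ge0 t x : 0 <= circle_heat_kernel t x.
Proof. by rewrite fine_ge0// periodized_heat_kernel_ge0. Qed.

Lemma measurable_circle_heat_kernel t :
  measurable_fun [set: R] (circle_heat_kernel t).
Proof.
by apply: measurableT_comp => //; exact: measurable_periodized_heat_kernel.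
Qed.

Lemma bounded_mfun_circle_heat_kernel t r : 0 < t ->
  bounded_mfun `[- r, r] (circle_heat_kernel t).
Proof.
move=> t_gt0; have [C C_ub] := periodized_heat_kernel_bounded r t_gt0; split.
  by apply: measurable_funTS; exact: measurable_circle_heat_kernel.
exists C => x /=; rewrite in_itv /= -ler_norml => /C_ub.
by rewrite -circle_heat_kernelE// lee_fin ger0_norm ?circle_heat_kernel_ge0.
Qed.

Lemma circle_heat_kernel_chapman_kolmogorov s t x y : 0 < s -> 0 < t ->
  (\int[mu]_(z in `[0%R, period[)
     (circle_heat_kernel s (x - z) * circle_heat_kernel t (y - z))%:E =
   (circle_heat_kernel (s + t) (x - y))%:E)%E.
Proof.
move=> s_gt0 t_gt0; rewrite circle_heat_kernelE ?addr_gt0//.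
under eq_integral do rewrite EFinM !circle_heat_kernelE//.
rewrite integral_periodizeM//; apply: eq_esum => n _ /=.
under eq_integral do rewrite -EFinM.
by rewrite line_heat_kernel_chapman_kolmogorov// addrAC.
Qed.

End circle_heat_kernel.

Section torus_heat_kernel.
Context {R : realType}.
Implicit Types (s t : R) (x y : R * R).

Lemma heat_kernelE t x : 0 < t ->
  heat_kernel t x = circle_heat_kernel t x.1 * circle_heat_kernel t x.2.
Proof.
move=> t_gt0.
rewrite -[RHS]/(fine (_ * _)%:E) EFinM !circle_heat_kernelE//; congr fine.
rewrite ge0_esumM; [|by move=> n; rewrite lee_fin line_heat_kernel_ge0..].
apply: eq_esum => m _ /=.
rewrite -EFinM /line_heat_kernel mulrACA -invfM -expr2.
rewrite sqr_sqrtr; last by rewrite !mulr_ge0 ?pi_ge0 ?ltW.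
by rewrite div1r -expRD -opprD -mulrDl.
Qed.

Lemma heat_kernel_chapman_kolmogorov s t x y : 0 < s -> 0 < t ->
  intO (fun z => heat_kernel s (x - z) * heat_kernel t (y - z)) =
  heat_kernel (s + t) (x - y).
Proof.
move=> s_gt0 t_gt0; rewrite heat_kernelE ?addr_gt0//.
pose h (a b c : R) :=
  circle_heat_kernel s (a - c) * circle_heat_kernel t (b - c).
have mh a b D : measurable_fun D (EFin \o h a b).
  apply/measurable_EFinP; apply: measurable_funTS; apply: measurable_funM;
    by apply: measurable_fun_reflect; exact: measurable_circle_heat_kernel.
have h_ge0 a b c : (0 <= (EFin \o h a b) c)%E.
  by rewrite lee_fin mulr_ge0 ?circle_heat_kernel_ge0.
rewrite -[RHS]/(fine (_ * _)%:E) EFinM.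
rewrite -!circle_heat_kernel_chapman_kolmogorov//.
rewrite -ge0_integral_setXM//; [|exact: mh|by move=> c _; exact: h_ge0
                                 |exact: mh|by move=> c _; exact: h_ge0].
rewrite /intO /Rintegral; congr fine; apply: eq_integral => z _.
by rewrite !heat_kernelE// -EFinM mulrACA.
Qed.

End torus_heat_kernel.

(** * The iteration on the torus *)

Section torus.
Context {R : realType}.
Notation mu :=
  (sigma_finite_product (@lebesgue_measure R) (@lebesgue_measure R)).
Notation period := (2 * pi).

Lemma measurable_Omega : measurable (Omega R).
Proof. by apply: measurableX; exact: measurable_itv. Qed.

Lemma leb2_Omega_fin : (mu (Omega R) < +oo)%E.
Proof.
rewrite /= product_measure1E//= lebesgue_measure_itv /= lte_fin.
by rewrite ifT ?mulr_gt0 ?pi_gt0// oppr0 adde0 -EFinM ltry.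
Qed.

Lemma bounded_heat_kernel t : 0 < t ->
  bounded_kernel (Omega R) (Omega R) (fun x y => heat_kernel t (x - y)).
Proof.
move=> t_gt0.
have mI : measurable (`[- period, period]%classic : set R).
  exact: measurable_itv.
have bcirc := bounded_mfun_circle_heat_kernel period t_gt0.
have sub_in_itv (a b : R) : a \in `[0, period[ -> b \in `[0, period[ ->
    a - b \in `[- period, period].
  by rewrite !in_itv /= => /andP[? ?] /andP[? ?]; apply/andP; split; lra.
rewrite /bounded_kernel; under eq_fun do rewrite heat_kernelE//.
apply: bounded_mfunM; apply: (bounded_mfun_comp mI _ _ bcirc) => [|p].
- apply: measurable_funB; apply: measurableT_comp => //; exact: measurable_fst.
- by move=> [[p11 _] [p21 _]]; exact: sub_in_itv.
- apply: measurable_funB; apply: measurableT_comp => //; exact: measurable_fst.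
- by move=> [[_ p12] [_ p22]]; exact: sub_in_itv.
Qed.

Lemma psd_heat_kernel t : 0 < t ->
  psd_kernel mu (Omega R) (fun x y => heat_kernel t (x - y)).
Proof.
move=> t_gt0; have t2_gt0 : 0 < t / 2 by rewrite divr_gt0.
have mOmega := measurable_Omega; have Omega_lty := leb2_Omega_fin.
have bphi := bounded_heat_kernel t2_gt0.
have bG := bounded_heat_kernel t_gt0.
apply: (psd_kernel_gram (mu := mu) mOmega Omega_lty (nu := mu)
  mOmega Omega_lty bphi bG) => x y _ _.
by rewrite [in LHS](splitr t) -heat_kernel_chapman_kolmogorov.
Qed.

Lemma torus_threshold_step (tau lambda : R) (F1 F2 v w : R * R -> R) :
  0 < tau -> 0 <= lambda ->
  (leb2 R).-integrable (Omega R) (EFin \o F1) ->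
  (leb2 R).-integrable (Omega R) (EFin \o F2) ->
  measurable_fun (Omega R) w -> (forall x, Omega R x -> 0 <= w x <= 1) ->
  (forall x, Omega R x ->
     v x = if F1 x - F2 x + lambda * Num.sqrt (pi / tau) *
         convO (heat_kernel tau) (fun y => 1 - 2 * w y) x <= 0 then 1 else 0) ->
  [/\ measurable_fun (Omega R) v, forall x, Omega R x -> 0 <= v x <= 1 &
      energy tau lambda F1 F2 v <= energy tau lambda F1 F2 w].
Proof.
move=> tau_gt0 lambda_ge0 iF1 iF2 mw w01 vE.
have bw := bounded_mfun_unit mw w01.
have bG := bounded_heat_kernel tau_gt0.
have weight_ge0 : 0 <= lambda * Num.sqrt (pi / tau).
  by rewrite mulr_ge0 ?sqrtr_ge0.
pose grad := energy_gradient mu (Omega R) (fun x y => heat_kernel tau (x - y))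
  (lambda * Num.sqrt (pi / tau)) F1 F2 w.
have {}vE x : Omega R x -> v x = if grad x <= 0 then 1 else 0 by exact: vE.
have mOmega := measurable_Omega; have Omega_lty := leb2_Omega_fin; split.
- exact: (measurable_threshold (mu := mu) mOmega Omega_lty bG iF1 iF2 bw vE).
- exact: (threshold_unit (mu := mu) vE).
- exact: (threshold_energy_le (mu := mu) mOmega Omega_lty bG iF1 iF2 bw vE
    weight_ge0 (psd_heat_kernel tau_gt0) w01).
Qed.

End torus.

Theorem theorem1 (R : realType) (tau lambda : R) (f : R * R -> R)
  (T : Type) (S : set T)
  (F1 F2 : (R * R -> R) -> T -> R * R -> R)
  (u : nat -> R * R -> R) (Theta : nat -> T) :
  0 < tau -> 0 < lambda ->
  (forall th, S th -> (leb2 R).-integrable (Omega R) (EFin \o F1 f th)) ->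
  (forall th, S th -> (leb2 R).-integrable (Omega R) (EFin \o F2 f th)) ->
  measurable_fun (Omega R) (u 1%N) ->
  (forall x, u 1%N x = 0 \/ u 1%N x = 1) ->
  (forall k, (1 <= k)%N -> S (Theta k) /\
     forall th, S th ->
       fidelity (F1 f (Theta k)) (F2 f (Theta k)) (u k) <=
       fidelity (F1 f th) (F2 f th) (u k)) ->
  (forall k, (1 <= k)%N -> forall x,
     let phi := F1 f (Theta k) x - F2 f (Theta k) x +
       lambda * Num.sqrt (pi / tau) *
         convO (heat_kernel tau) (fun y => 1 - 2 * u k y) x in
     u k.+1 x = if phi <= 0 then 1 else 0) ->
  forall k, (1 <= k)%N ->
    energy tau lambda (F1 f (Theta k.+1)) (F2 f (Theta k.+1)) (u k.+1) <=
    energy tau lambda (F1 f (Theta k)) (F2 f (Theta k)) (u k).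
Proof.
move=> tau_gt0 /ltW lambda_ge0 iF1 iF2 mu1 u1_01 argmin threshold.
have step k (k_ge1 : (1 <= k)%N) muk uk01 :=
  torus_threshold_step (v := u k.+1) (w := u k) tau_gt0 lambda_ge0
    (iF1 _ (argmin k k_ge1).1) (iF2 _ (argmin k k_ge1).1) muk uk01
    (fun x _ => threshold k k_ge1 x).
have u_unit k : (1 <= k)%N ->
    measurable_fun (Omega R) (u k) /\ forall x, Omega R x -> 0 <= u k x <= 1.
  elim: k => [//|[_ _|k /(_ isT) [muk uk01] _]].
    by split => // x _; case: (u1_01 x) => ->; rewrite lexx ler01.
  by have [] := step k.+1 isT muk uk01.
move=> k k_ge1; have [muk uk01] := u_unit k k_ge1.
have [_ _] := step k k_ge1 muk uk01; apply: le_trans.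
have [S_k _] := argmin k k_ge1; have [_ min_k1] := argmin k.+1 isT.
by rewrite /energy lerD2r; exact: min_k1.
Qed.
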